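(* The group $Q(2,1)$ is isomorphic to the trefoil knot group $T \cong \langle x, y : xyx = yxy \rangle$.
   Context: $Q(2,1)$ is the group with generators $x_0, x_1$ and the two relators $u\,\theta(u)$ and $\theta(u)\,u$, where $u = x_0 x_1 x_0^{-1} x_1^{-2}$ and $\theta$ is the automorphism of the free group $F(x_0,x_1)$ interchanging $x_0$ and $x_1$. *)

(* Defs.v *)
From HB Require Import structures.
From mathcomp Require Import ssreflect ssrfun ssrbool eqtype ssrnat seq choice.
From mathcomp Require Import fintype generic_quotient monoid.
From mathcomp Require Import boolp classical_sets.

Set Implicit Arguments.
Unset Strict Implicit.
Unset Printing Implicit Defensive.


Local Open Scope group_scope.
Local Open Scope quotient_scope.

Section FreeGroup.
Variable X : choiceType.

(* The letter (x, false) stands for x and (x, true) for x^-1. *)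
Definition word := seq (X * bool).

Inductive free_eq : word -> word -> Prop :=
| FreeCancel w1 x b w2 : free_eq (w1 ++ (x, b) :: (x, ~~ b) :: w2) (w1 ++ w2)
| FreeRefl w : free_eq w w
| FreeSym w1 w2 : free_eq w1 w2 -> free_eq w2 w1
| FreeTrans w1 w2 w3 : free_eq w1 w2 -> free_eq w2 w3 -> free_eq w1 w3.

Definition free_eqb : rel word := fun w1 w2 => `[< free_eq w1 w2 >].

Lemma free_eqb_equiv : equiv_class_of free_eqb.
Proof.
split=> [w|w1 w2|w2 w1 w3].
- exact/asboolP/FreeRefl.
- by apply/asboolP/asboolP => /FreeSym.
- by move=> /asboolP e12 /asboolP e23; apply/asboolP/(FreeTrans e12).
Qed.

Canonical free_eqb_equiv_rel := EquivRelPack free_eqb_equiv.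

Definition freeGroup := {eq_quot free_eqb}.
HB.instance Definition _ := Choice.on freeGroup.
HB.instance Definition _ := EqQuotient.on freeGroup.

Definition free_pi (w : word) : freeGroup := \pi w.

Lemma free_piW (P : freeGroup -> Prop) :
  (forall w, P (free_pi w)) -> forall g, P g.
Proof. exact: quotW. Qed.

Lemma free_pi_eq (w1 w2 : word) :
  free_pi w1 = free_pi w2 <-> free_eq w1 w2.
Proof.
split; last by move=> e12; apply/eqmodP/asboolP.
by move/eqmodP/asboolP.
Qed.

Lemma free_eq_cat u1 u2 v1 v2 :
  free_eq u1 u2 -> free_eq v1 v2 -> free_eq (u1 ++ v1) (u2 ++ v2).
Proof.
move=> eu ev; apply: (@FreeTrans _ (u2 ++ v1)).
  elim: eu => [w1 x b w2|w|w1 w2 _|w1 w2 w3 _ e12 _ e23].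
  - by rewrite -!catA /=; apply: FreeCancel.
  - exact: FreeRefl.
  - exact: FreeSym.
  - exact: FreeTrans e12 e23.
elim: ev => [w1 x b w2|w|w1 w2 _|w1 w2 w3 _ e12 _ e23].
- by rewrite !catA; apply: FreeCancel.
- exact: FreeRefl.
- exact: FreeSym.
- exact: FreeTrans e12 e23.
Qed.

Definition inv_word (w : word) : word := rev [seq (l.1, ~~ l.2) | l <- w].

Lemma inv_word_cat w1 w2 : inv_word (w1 ++ w2) = inv_word w2 ++ inv_word w1.
Proof. by rewrite /inv_word map_cat rev_cat. Qed.

Lemma inv_wordK : involutive inv_word.
Proof.
move=> w; rewrite /inv_word map_rev revK -map_comp -[RHS]map_id.
by apply: eq_map => -[x b] /=; rewrite negbK.
Qed.

Lemma free_eq_inv w1 w2 : free_eq w1 w2 -> free_eq (inv_word w1) (inv_word w2).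
Proof.
elim=> {w1 w2} [w1 x b w2|w|w1 w2 _|w1 w2 w3 _ e12 _ e23].
  rewrite -(cat1s (x, b)) -(cat1s (x, ~~ b)) !inv_word_cat -!catA /= negbK.
  exact: FreeCancel.
- exact: FreeRefl.
- exact: FreeSym.
- exact: FreeTrans e12 e23.
Qed.

Lemma free_eq_mulV w : free_eq (w ++ inv_word w) [::].
Proof.
elim: w => [|[x b] w IHw]; first exact: FreeRefl.
have -> : ((x, b) :: w) ++ inv_word ((x, b) :: w) =
    [:: (x, b)] ++ (w ++ inv_word w) ++ [:: (x, ~~ b)].
  by rewrite -(cat1s (x, b) w) inv_word_cat -!catA.
apply: (FreeTrans _ (@FreeCancel [::] x b [::])).
apply: (free_eq_cat (FreeRefl _)).
exact: (free_eq_cat IHw (FreeRefl [:: (x, ~~ b)])).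
Qed.

Definition free_mul (g h : freeGroup) : freeGroup :=
  free_pi (repr g ++ repr h).
Definition free_one : freeGroup := free_pi [::].
Definition free_inv (g : freeGroup) : freeGroup :=
  free_pi (inv_word (repr g)).

Lemma free_repr_pi (w : word) : free_eq (repr (free_pi w)) w.
Proof. by apply/free_pi_eq; apply: reprK. Qed.

Lemma free_mul_pi w1 w2 :
  free_mul (free_pi w1) (free_pi w2) = free_pi (w1 ++ w2).
Proof. by apply/free_pi_eq/free_eq_cat; apply: free_repr_pi. Qed.

Lemma free_inv_pi w : free_inv (free_pi w) = free_pi (inv_word w).
Proof. by apply/free_pi_eq/free_eq_inv; apply: free_repr_pi. Qed.

Lemma free_mulA : associative free_mul.
Proof.
elim/free_piW=> g; elim/free_piW=> h; elim/free_piW=> k.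
by rewrite (free_mul_pi h k) (free_mul_pi g h) !free_mul_pi catA.
Qed.

Lemma free_mul1 : left_id free_one free_mul.
Proof. by elim/free_piW=> w; rewrite free_mul_pi. Qed.

Lemma free_mulr1 : right_id free_one free_mul.
Proof. by elim/free_piW=> w; rewrite free_mul_pi cats0. Qed.

Lemma free_mulrV : right_inverse free_one free_inv free_mul.
Proof.
elim/free_piW=> w; rewrite free_inv_pi free_mul_pi.
exact/free_pi_eq/free_eq_mulV.
Qed.

Lemma free_mulV : left_inverse free_one free_inv free_mul.
Proof.
elim/free_piW=> w; rewrite free_inv_pi free_mul_pi -{2}[w]inv_wordK.
exact/free_pi_eq/free_eq_mulV.
Qed.

HB.instance Definition _ := isGroup.Build freeGroup
  free_mulA free_mul1 free_mulr1 free_mulV free_mulrV.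

Definition free_gen (x : X) : freeGroup := free_pi [:: (x, false)].

Lemma free_piM w1 w2 :
  free_pi (w1 ++ w2) = free_pi w1 * free_pi w2.
Proof. by rewrite -free_mul_pi. Qed.

End FreeGroup.

Section FreeLift.
Variables (X : choiceType) (G : groupType) (f : X -> G).

Fixpoint word_eval (w : word X) : G :=
  if w is (x, b) :: w' then (if b then (f x)^-1 else f x) * word_eval w' else 1.

Lemma word_eval_cat w1 w2 : word_eval (w1 ++ w2) = word_eval w1 * word_eval w2.
Proof. by elim: w1 => [|[x b] w1 /= ->]; rewrite ?mul1g ?mulgA. Qed.

Lemma word_eval_free_eq w1 w2 : free_eq w1 w2 -> word_eval w1 = word_eval w2.
Proof.
elim=> [u x [] v|//|//|? ? ? _ -> _ -> //]; rewrite !word_eval_cat /=.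
  by rewrite mulKg.
by rewrite mulVKg.
Qed.

(* The homomorphism freeGroup X -> G extending f. *)
Definition free_lift (g : freeGroup X) : G := word_eval (repr g).

Lemma free_lift_pi w : free_lift (free_pi w) = word_eval w.
Proof. exact/word_eval_free_eq/free_repr_pi. Qed.

Lemma free_liftM : {morph free_lift : g h / g * h}.
Proof.
elim/free_piW=> w1; elim/free_piW=> w2; rewrite -free_piM !free_lift_pi.
exact: word_eval_cat.
Qed.

HB.instance Definition _ :=
  isMultiplicative.Build (freeGroup X) G free_lift free_liftM.

Lemma free_lift_gen x : free_lift (free_gen x) = f x.
Proof. by rewrite free_lift_pi /= mulg1. Qed.

End FreeLift.

Lemma free_morph_ext (X : choiceType) (G : groupType)
    (f g : {multiplicative freeGroup X -> G}) :
  (forall x, f (free_gen x) = g (free_gen x)) -> f =1 g.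
Proof.
move=> efg; have f1 (h : {multiplicative freeGroup X -> G}) : h 1 = 1.
  by apply: (mulgI (h 1)); rewrite -gmulfM !mulg1.
elim/free_piW; elim=> [|[x b] w IHw]; first by rewrite !f1.
have -> : free_pi ((x, b) :: w) = free_pi [:: (x, b)] * free_pi w.
  by rewrite -free_piM.
rewrite !gmulfM IHw; congr (_ * _); case: b; last exact: efg.
have -> : free_pi [:: (x, true)] = (free_gen x)^-1.
  by rewrite -[RHS]/(free_inv _) free_inv_pi.
have fV (h : {multiplicative freeGroup X -> G}) y : h y^-1 = (h y)^-1.
  by apply: (mulgI (h y)); rewrite -gmulfM !mulgV f1.
by rewrite !fV efg.
Qed.

Section QuotientGroup.
Variables (G : groupType) (R : set G).

Inductive normal_closure : G -> Prop :=
| NclIn r : R r -> normal_closure r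
| Ncl1 : normal_closure 1
| NclM g h : normal_closure g -> normal_closure h -> normal_closure (g * h)
| NclV g : normal_closure g -> normal_closure g^-1
| NclJ g h : normal_closure g -> normal_closure (g ^ h).

Definition ncl_eqb : rel G := fun g h => `[< normal_closure (g^-1 * h) >].

Lemma ncl_eqb_equiv : equiv_class_of ncl_eqb.
Proof.
have sym g h : normal_closure (g^-1 * h) -> normal_closure (h^-1 * g).
  by move/NclV; rewrite invgM invgK.
split=> [g|g h|h g k].
- by apply/asboolP; rewrite mulVg; apply: Ncl1.
- by apply/asboolP/asboolP; apply: sym.
- move=> /asboolP gh /asboolP hk; apply/asboolP.
  by have := NclM gh hk; rewrite mulgA mulgK.
Qed.

Canonical ncl_eqb_equiv_rel := EquivRelPack ncl_eqb_equiv.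

(* The quotient of G by the normal closure of R. *)
Definition quotGroup := {eq_quot ncl_eqb}.
HB.instance Definition _ := Choice.on quotGroup.
HB.instance Definition _ := EqQuotient.on quotGroup.

Definition quot_pi (g : G) : quotGroup := \pi g.

Lemma quot_piW (P : quotGroup -> Prop) :
  (forall g, P (quot_pi g)) -> forall a, P a.
Proof. exact: quotW. Qed.

Lemma quot_pi_eq (g h : G) :
  quot_pi g = quot_pi h <-> normal_closure (g^-1 * h).
Proof.
split; last by move=> gh; apply/eqmodP/asboolP.
by move/eqmodP/asboolP.
Qed.

Definition quot_mul (a b : quotGroup) : quotGroup :=
  quot_pi (repr a * repr b).
Definition quot_one : quotGroup := quot_pi 1.
Definition quot_inv (a : quotGroup) : quotGroup := quot_pi (repr a)^-1.

Lemma quot_repr_pi (g : G) : normal_closure ((repr (quot_pi g))^-1 * g).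
Proof. by apply/quot_pi_eq; apply: reprK. Qed.

Lemma quot_mul_pi g h :
  quot_mul (quot_pi g) (quot_pi h) = quot_pi (g * h).
Proof.
apply/quot_pi_eq; have gg' := quot_repr_pi g; have hh' := quot_repr_pi h.
set g' := repr (quot_pi g) in gg' *; set h' := repr (quot_pi h) in hh' *.
have -> : (g' * h')^-1 * (g * h) = (h'^-1 * h) * ((g'^-1 * g) ^ h).
  by rewrite /conjg invgM !mulgA mulgK.
exact: NclM hh' (NclJ _ gg').
Qed.

Lemma quot_inv_pi g : quot_inv (quot_pi g) = quot_pi g^-1.
Proof.
apply/quot_pi_eq; have := quot_repr_pi g; set g' := repr _ => gg'.
have -> : g'^-1^-1 * g^-1 = ((g'^-1 * g) ^ g^-1)^-1.
  by rewrite /conjg mulgK invgM !invgK.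
exact: NclV (NclJ _ gg').
Qed.

Lemma quot_mulA : associative quot_mul.
Proof.
elim/quot_piW=> g; elim/quot_piW=> h; elim/quot_piW=> k.
by rewrite (quot_mul_pi h k) (quot_mul_pi g h) !quot_mul_pi mulgA.
Qed.

Lemma quot_mul1 : left_id quot_one quot_mul.
Proof. by elim/quot_piW=> g; rewrite quot_mul_pi mul1g. Qed.

Lemma quot_mulr1 : right_id quot_one quot_mul.
Proof. by elim/quot_piW=> g; rewrite quot_mul_pi mulg1. Qed.

Lemma quot_mulV : left_inverse quot_one quot_inv quot_mul.
Proof. by elim/quot_piW=> g; rewrite quot_inv_pi quot_mul_pi mulVg. Qed.

Lemma quot_mulrV : right_inverse quot_one quot_inv quot_mul.
Proof. by elim/quot_piW=> g; rewrite quot_inv_pi quot_mul_pi mulgV. Qed.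

HB.instance Definition _ := isGroup.Build quotGroup
  quot_mulA quot_mul1 quot_mulr1 quot_mulV quot_mulrV.

End QuotientGroup.

Definition presentedGroup (X : choiceType) (R : set (freeGroup X)) : groupType :=
  quotGroup R.

Definition x0 : freeGroup 'I_2 := free_gen (ord0 : 'I_2).
Definition x1 : freeGroup 'I_2 := free_gen (ord_max : 'I_2).

Definition theta : freeGroup 'I_2 -> freeGroup 'I_2 :=
  free_lift (fun i : 'I_2 => free_gen (rev_ord i)).
HB.instance Definition _ := Multiplicative.on theta.

Lemma theta_x0 : theta x0 = x1.
Proof. by rewrite /theta free_lift_gen; congr free_gen; apply: val_inj. Qed.

Lemma theta_x1 : theta x1 = x0.
Proof. by rewrite /theta free_lift_gen; congr free_gen; apply: val_inj. Qed.

Lemma thetaK : involutive theta.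
Proof.
apply: (@free_morph_ext _ _ (theta \o theta) idfun) => i /=.
by rewrite /theta !free_lift_gen rev_ordK.
Qed.

Definition u : freeGroup 'I_2 := x0 * x1 * x0^-1 * x1 ^- 2.

Definition Q21 : groupType :=
  presentedGroup [set r | r = u * theta u \/ r = theta u * u]%classic.

(* The relation xyx = yxy is the relator xyx(yxy)^-1; here x, y are x0, x1. *)
Definition trefoilGroup : groupType :=
  presentedGroup [set r | r = (x0 * x1 * x0) * (x1 * x0 * x1)^-1]%classic.

(* Main.v *)
Require Import Defs.
From HB Require Import structures.
From mathcomp Require Import ssreflect ssrfun ssrbool eqtype seq choice.
From mathcomp Require Import fintype generic_quotient monoid.
From mathcomp Require Import classical_sets.

(** Write [phi] for the involution of [F(x0, x1)] that fixes [x0] and inverts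
    [x1].  Each of the relators [u * theta u] and [theta u * u] ends in the
    inverse of a square; moving that square to the front, by conjugation, leaves
    a word whose image under [phi] is a conjugate of the inverse of the braid
    relator [x0 x1 x0 (x1 x0 x1)^-1].  Hence [phi] exchanges the normal closures
    of the two sets of relators and induces mutually inverse isomorphisms of the
    quotients. *)

Set Implicit Arguments.
Unset Strict Implicit.
Unset Printing Implicit Defensive.

Local Open Scope group_scope.

Lemma quot_piM (G : groupType) (R : set G) : {morph quot_pi R : g h / g * h}.
Proof. by move=> g h; rewrite -quot_mul_pi. Qed.

Section QuotientMap.
Variables (G H : groupType) (R : set G) (S : set H).
Variable f : UMagmaMorphism.type G H.

(* The proof argument is what lets [quot_map] carry a canonical morphism
   structure. *)
Definition quot_map of (forall r, R r -> normal_closure S (f r)) :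
    quotGroup R -> quotGroup S :=
  fun a => quot_pi S (f (repr a)).

Hypothesis fRS : forall r, R r -> normal_closure S (f r).

Lemma normal_closure_morph g : normal_closure R g -> normal_closure S (f g).
Proof.
elim=> {g} [r /fRS //||g h _ Sg _ Sh|g _ Sg|g h _ Sg].
- by rewrite gmulf1; apply: Ncl1.
- by rewrite gmulfM; apply: NclM.
- by rewrite gmulfV; apply: NclV.
- by rewrite gmulfJ; apply: NclJ.
Qed.

Lemma quot_map_pi g : quot_map fRS (quot_pi R g) = quot_pi S (f g).
Proof.
apply/quot_pi_eq; rewrite -gmulfV -gmulfM.
exact/normal_closure_morph/quot_repr_pi.
Qed.

Lemma quot_mapM : {morph quot_map fRS : a b / a * b}.
Proof.
elim/quot_piW=> g; elim/quot_piW=> h.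
by rewrite -quot_piM !quot_map_pi gmulfM quot_piM.
Qed.

HB.instance Definition _ :=
  isMultiplicative.Build (quotGroup R) (quotGroup S) (quot_map fRS) quot_mapM.

End QuotientMap.

Lemma quot_mapK (G H : groupType) (R : set G) (S : set H)
    (f : UMagmaMorphism.type G H) (g : UMagmaMorphism.type H G)
    (fRS : forall r, R r -> normal_closure S (f r))
    (gSR : forall s, S s -> normal_closure R (g s)) :
  cancel f g -> cancel (quot_map fRS) (quot_map gSR).
Proof. by move=> fK; elim/quot_piW=> k; rewrite !quot_map_pi fK. Qed.

Lemma quot_isomorphic (G H : groupType) (R : set G) (S : set H)
    (f : UMagmaMorphism.type G H) (g : UMagmaMorphism.type H G) :
  cancel f g -> cancel g f ->
  (forall r, R r -> normal_closure S (f r)) ->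
  (forall s, S s -> normal_closure R (g s)) ->
  exists h : {multiplicative quotGroup R -> quotGroup S}, bijective h.
Proof.
move=> fK gK fRS gSR.
by exists (quot_map fRS), (quot_map gSR); apply: quot_mapK.
Qed.

Section FreeGroupMorphism.
Variables (X : choiceType) (G : groupType) (f : X -> G).

Lemma free_lift1 : free_lift f 1 = 1.
Proof. exact: (free_lift_pi f [::]). Qed.

HB.instance Definition _ :=
  Multiplicative_isUMagmaMorphism.Build
    (freeGroup X) G (free_lift f) free_lift1.

End FreeGroupMorphism.

HB.instance Definition _ := UMagmaMorphism.on theta.

Section InvertGenerators.
Variables (X : choiceType) (P : pred X).

Definition invert_gens : freeGroup X -> freeGroup X :=
  free_lift (fun x => if P x then (free_gen x)^-1 else free_gen x).

HB.instance Definition _ := UMagmaMorphism.on invert_gens.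

Lemma invert_gensE x :
  invert_gens (free_gen x) = if P x then (free_gen x)^-1 else free_gen x.
Proof. exact: free_lift_gen. Qed.

Lemma invert_gensK : involutive invert_gens.
Proof.
apply: (@free_morph_ext _ _ (invert_gens \o invert_gens) idfun) => x /=.
rewrite invert_gensE; case Px: (P x); last by rewrite invert_gensE Px.
by rewrite gmulfV /= invert_gensE Px invgK.
Qed.

End InvertGenerators.

Definition Q21_relators : set (freeGroup 'I_2) :=
  [set r | r = u * theta u \/ r = theta u * u]%classic.

Definition braid_relator : freeGroup 'I_2 := (x0 * x1 * x0) * (x1 * x0 * x1)^-1.

Definition trefoil_relators : set (freeGroup 'I_2) :=
  [set braid_relator]%classic.

Definition invert_x1 : freeGroup 'I_2 -> freeGroup 'I_2 :=
  invert_gens (pred1 ord_max).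
HB.instance Definition _ := UMagmaMorphism.on invert_x1.

Lemma invert_x1K : involutive invert_x1.
Proof. exact: invert_gensK. Qed.

Lemma invert_x1_x0 : invert_x1 x0 = x0.
Proof. exact: invert_gensE. Qed.

Lemma invert_x1_x1 : invert_x1 x1 = x1^-1.
Proof. exact: invert_gensE. Qed.

Lemma theta_u : theta u = x1 * x0 * x1^-1 * x0 ^- 2.
Proof. by rewrite !gmulfM !gmulfV gmulfXn /= theta_x0 theta_x1. Qed.

Lemma invert_x1_u : invert_x1 u = x0 * x1^-1 * x0^-1 * x1 ^+ 2.
Proof.
by rewrite !gmulfM !gmulfV gmulfXn /= invert_x1_x0 invert_x1_x1 expVgn invgK.
Qed.

Lemma invert_x1_theta_u : invert_x1 (theta u) = x1^-1 * x0 * x1 * x0 ^- 2.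
Proof.
by rewrite theta_u !gmulfM !gmulfV gmulfXn /= invert_x1_x0 invert_x1_x1 invgK.
Qed.

Lemma invert_x1_u_theta_u :
  invert_x1 (u * theta u) = braid_relator^-1 ^ (x0 * x1 * x0^-1).
Proof.
by rewrite gmulfM /= invert_x1_u invert_x1_theta_u /conjg !expg2 !gnorm.
Qed.

Lemma invert_x1_theta_u_u :
  invert_x1 (theta u * u) = braid_relator^-1 ^ (x1 ^+ 2).
Proof.
by rewrite gmulfM /= invert_x1_u invert_x1_theta_u /conjg !expg2 !gnorm.
Qed.

Lemma invert_x1_braid_relator :
  invert_x1 braid_relator = (theta u * u)^-1 ^ (x1 ^+ 2).
Proof.
apply: (can_inj invert_x1K); rewrite invert_x1K gmulfJ gmulfV gmulfXn /=.
by rewrite invert_x1_theta_u_u invert_x1_x1 expVgn !conjVg invgK conjgK.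
Qed.

Lemma invert_x1_Q21_relators r :
  Q21_relators r -> normal_closure trefoil_relators (invert_x1 r).
Proof.
case=> ->; rewrite ?invert_x1_u_theta_u ?invert_x1_theta_u_u;
  exact/NclJ/NclV/NclIn.
Qed.

Lemma invert_x1_trefoil_relators r :
  trefoil_relators r -> normal_closure Q21_relators (invert_x1 r).
Proof.
by move=> ->; rewrite invert_x1_braid_relator; apply/NclJ/NclV/NclIn; right.
Qed.

Theorem lemma5p8 :
  exists f : {multiplicative Q21 -> trefoilGroup}, bijective f.
Proof.
exact: (quot_isomorphic invert_x1K invert_x1K
          invert_x1_Q21_relators invert_x1_trefoil_relators).
Qed.
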